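(* Let $k$ be a field and let $F \colon \mathsf{Alg}^{\mathrm{op}} \to \mathsf{Coalg}$ be a subfunctor of the finite dual functor $(-)^\circ \colon \mathsf{Alg}^{\mathrm{op}} \to \mathsf{Coalg}$. If $F(\mathbb{M}_d(k)) = \mathbb{M}_d(k)^*$ for all integers $d \geq 0$, then $F$ is equal to the finite dual functor, i.e. $F(A) = A^\circ$ for every $k$-algebra $A$.
   Context: $\mathsf{Alg}$ is the category of unital associative $k$-algebras with unital homomorphisms, and $\mathsf{Coalg}$ is the category of counital coassociative $k$-coalgebras. For a $k$-algebra $A$, the finite dual $A^\circ \subseteq A^* = \operatorname{Hom}_k(A,k)$ is the set of linear functionals whose kernel contains a two-sided ideal of $A$ of finite codimension. It is a coalgebra: comultiplication is the restriction of the dual $m^*$ of the multiplication $m\colon A\otimes A\to A$ (which maps $A^\circ$ into $A^\circ\otimes A^\circ\subseteq (A\otimes A)^*$), and the counit is the dual of the unit (evaluation at $1$). Equivalently $A^\circ \cong \varinjlim (A/I)^*$ as coalgebras, over ideals $I$ of finite codimension. An algebra homomorphism $f\colon A\to B$ induces $f^\circ\colon B^\circ\to A^\circ$, $\phi\mapsto \phi\circ f$, making $(-)^\circ$ a functor $\mathsf{Alg}^{\mathrm{op}}\to\mathsf{Coalg}$. If $A$ is finite-dimensional then $A^\circ = A^*$. A subfunctor $F$ of $(-)^\circ$ assigns to each algebra $A$ a subcoalgebra $F(A)\subseteq A^\circ$ such that, for every homomorphism $f\colon A\to B$, $f^\circ(F(B))\subseteq F(A)$ and $F(f)$ is the restriction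 of $f^\circ$. $\mathbb{M}_d(k)$ is the algebra of $d\times d$ matrices over $k$ (the zero algebra if $d=0$). *)

(* Defs.v *)
From HB Require Import structures.
From mathcomp Require Import all_boot all_order all_algebra.
From mathcomp Require Import boolp classical_sets.

Set Implicit Arguments.
Unset Strict Implicit.
Unset Printing Implicit Defensive.

Import GRing.Theory.
Local Open Scope ring_scope.
Local Open Scope classical_set_scope.

(* MathComp's [algType k] is built on [nzRingType], hence excludes the zero
   algebra, which is needed here for the 0 x 0 matrices.  [pzAlgType k] imposes
   the same axioms on a [pzRingType].  It is not an HB structure because HB
   accepts no second join of the ring and module hierarchies. *)
Record pzAlgType (k : fieldType) := PzAlgType {
  pzalg_ring : pzRingType;
  pzalg_scale : k -> pzalg_ring -> pzalg_ring;
  pzalg_scalerA : forall a b x,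
    pzalg_scale a (pzalg_scale b x) = pzalg_scale (a * b) x;
  pzalg_scale1r : forall x, pzalg_scale 1 x = x;
  pzalg_scalerDr : forall a x y,
    pzalg_scale a (x + y) = pzalg_scale a x + pzalg_scale a y;
  pzalg_scalerDl : forall x a b,
    pzalg_scale (a + b) x = pzalg_scale a x + pzalg_scale b x;
  pzalg_scalerAl : forall a x y,
    pzalg_scale a (x * y) = pzalg_scale a x * y;
  pzalg_scalerAr : forall a x y,
    pzalg_scale a (x * y) = x * pzalg_scale a y
}.

Definition pzalg_sort (k : fieldType) (A : pzAlgType k) : Type := pzalg_ring A.
Coercion pzalg_sort : pzAlgType >-> Sortclass.

HB.instance Definition _ (k : fieldType) (A : pzAlgType k) :=
  GRing.PzRing.copy (pzalg_sort A) (pzalg_ring A).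
HB.instance Definition _ (k : fieldType) (A : pzAlgType k) :=
  GRing.Zmodule_isLmodule.Build k (pzalg_sort A) (@pzalg_scalerA k A)
    (@pzalg_scale1r k A) (@pzalg_scalerDr k A) (@pzalg_scalerDl k A).

Definition matrix_alg (k : fieldType) (d : nat) : pzAlgType k :=
  @PzAlgType k 'M[k]_d *:%R (@scalerA _ _) (@scale1r _ _)
    (fun a x y => scalerDr a x y) (fun x a b => scalerDl x a b)
    (fun a x y => scalemxAl a x y) (fun a x y => scalemxAr a x y).

Section FiniteDual.
Variables (k : fieldType) (A : pzAlgType k).
Implicit Types (I : set A) (C : set {linear A -> k^o}).
Implicit Types (phi psi : {linear A -> k^o}).

(* Closure under opposites and scaling follows by multiplying by -1 and by
   c *: 1. *)
Record two_sided_ideal I : Prop := TwoSidedIdeal {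
  ideal0 : I 0;
  idealD : forall x y, I x -> I y -> I (x + y);
  idealMl : forall a x, I x -> I (a * x);
  idealMr : forall x a, I x -> I (x * a)
}.

(* The quotient A / I is spanned by the classes of finitely many v i. *)
Definition finite_codim I : Prop :=
  exists (n : nat) (v : 'I_n -> A), forall a : A,
    exists c : 'I_n -> k, I (a - \sum_(i < n) c i *: v i).

Definition finite_dual : set {linear A -> k^o} :=
  [set phi | exists I, [/\ two_sided_ideal I, finite_codim I
                         & I `<=` [set a | phi a = 0]]].

(* The dual m^* of the multiplication, (A (x) A)^* being identified with the
   bilinear forms on A. *)
Definition comul phi : A -> A -> k := fun a b => phi (a * b).

(* The subspace C (x) C of (A (x) A)^*, for C a subspace of A^*.  Over a field,
   A^* (x) A^* embeds into (A (x) A)^* by f (x) g |-> ((a, b) |-> f a * g b). *)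
Definition tensor_square C : set (A -> A -> k) :=
  [set beta | exists (n : nat) (f g : 'I_n -> {linear A -> k^o}),
     [/\ forall i, C (f i), forall i, C (g i)
       & forall a b, beta a b = \sum_(i < n) f i a * g i b]].

(* The counit phi |-> phi 1 of the finite dual restricts to any subspace, so that
   it adds no condition. *)
Record subcoalgebra C : Prop := Subcoalgebra {
  subcoalg_sub : C `<=` finite_dual;
  subcoalg0 : C \0;
  subcoalgD : forall phi psi, C phi -> C psi -> C (phi \+ psi);
  subcoalgZ : forall (c : k) phi, C phi -> C (c \*: phi);
  subcoalg_comul : forall phi, C phi -> tensor_square C (comul phi)
}.

End FiniteDual.

Arguments finite_dual {k} A _.

(* Unital algebra homomorphisms A -> B are the linear maps satisfying
   [monoid_morphism], and the induced map
   on finite duals sends phi to phi \o f. *)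
Record finite_dual_subfunctor (k : fieldType)
    (F : forall A : pzAlgType k, set {linear A -> k^o}) : Prop :=
  FiniteDualSubfunctor {
  subfunctor_obj : forall A : pzAlgType k, subcoalgebra (F A);
  subfunctor_map : forall (A B : pzAlgType k) (f : {linear A -> B}),
    monoid_morphism f ->
    forall phi : {linear B -> k^o}, F B phi -> F A (phi \o f)
}.

(* Main.v *)
Require Import Defs.
From HB Require Import structures.
From mathcomp Require Import all_boot all_order all_algebra.
From mathcomp Require Import boolp classical_sets.

(* Right multiplication on A / I, written in a basis of A / I, is a unital
   homomorphism from A to a matrix algebra, and every functional vanishing on I
   factors through it: phi a is a linear function of the action of a on the
   class of 1.  So every element of the finite dual is pulled back from the
   dual of a matrix algebra, which lies in F by hypothesis. *)

Import GRing.Theory.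
Local Open Scope ring_scope.
Local Open Scope classical_set_scope.

(** [F A] is a set of bundled maps, so the final factorization must be an equality of bundles; the
    fields other than the function are proofs, equal by irrelevance. *)
Lemma linear_ext {R : pzRingType} {U V : lmodType R} (f g : {linear U -> V}) :
  f =1 g -> f = g.
Proof.
case: f => f [[f0] [fZ]]; case: g => g [[g0] [gZ]] /= /funext fg.
case: _ / fg g0 gZ => g0 gZ.
by rewrite (Prop_irrelevance g0 f0) (Prop_irrelevance gZ fZ).
Qed.

Section QuotientBasis.
Set Implicit Arguments.
Unset Strict Implicit.
Context {k : fieldType} {A : pzAlgType k} {I : set A}.
Hypothesis idI : two_sided_ideal I.

Lemma idealZ (c : k) x : I x -> I (c *: x).
Proof.
move=> Ix; have -> : c *: x = (c *: (1 : A)) * x.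
  by rewrite -[in LHS](mul1r x); exact: (@pzalg_scalerAl k A).
exact: (idealMl idI).
Qed.

Lemma idealB x y : I x -> I y -> I (x - y).
Proof.
by move=> Ix Iy; apply: (idealD idI) => //; rewrite -scaleN1r; apply: idealZ.
Qed.

Lemma ideal_sum (n : nat) (x : 'I_n -> A) :
  (forall i, I (x i)) -> I (\sum_(i < n) x i).
Proof.
by move=> Ix; elim/big_ind: _ => //; [exact: (ideal0 idI) | exact: (idealD idI)].
Qed.

Definition spans_mod (n : nat) (v : 'I_n -> A) :=
  forall a, exists c : 'I_n -> k, I (a - \sum_(i < n) c i *: v i).

Definition free_mod (n : nat) (v : 'I_n -> A) :=
  forall c : 'I_n -> k, I (\sum_(i < n) c i *: v i) -> forall i, c i = 0.

Lemma spans_mod_drop (n : nat) (v : 'I_n.+1 -> A) (c : 'I_n.+1 -> k) i0 :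
    spans_mod v -> I (\sum_(i < n.+1) c i *: v i) -> c i0 != 0 ->
  spans_mod (fun j => v (lift i0 j)).
Proof.
move=> spv Ic c0 a; have [e Ie] := spv a.
(* Subtracting [e i0 / c i0] times the relation [c] from the expansion [e] of [a] cancels the
   coefficient of [v i0]. *)
exists (fun j => e (lift i0 j) - e i0 / c i0 * c (lift i0 j)).
have := idealD idI Ie (idealZ (e i0 / c i0) Ic).
rewrite !(bigD1_ord i0) //= scalerDr scalerA divfK // opprD !addrA.
rewrite scaler_sumr.
under [X in _ -> I (a - X)]eq_bigr do rewrite scalerBl -scalerA.
rewrite sumrB opprB.
set x := e i0 *: _; set s := \sum_(j < n) _; set t := \sum_(j < n) _.
suff -> : a - x - s + x + t = a + (t - s) by [].
by rewrite [a - x - s]addrAC subrK addrAC -addrA.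
Qed.

(** A spanning family of minimal length is free modulo [I]: a nontrivial relation would let one
    vector be dropped. *)
Lemma finite_codim_basis :
  finite_codim I -> exists (n : nat) (v : 'I_n -> A), spans_mod v /\ free_mod v.
Proof.
case=> m [v0 spv0].
have exP : exists n, `[< exists v : 'I_n -> A, spans_mod v >].
  by exists m; apply/asboolP; exists v0.
case: (ex_minnP exP) => n /asboolP[v spv] minn; exists n, v; split=> // c Ic i.
apply/eqP; apply: contraT => ci.
case: n => [|n] in v spv minn c Ic i ci *; first by case: i ci.
have := minn n; rewrite ltnn; apply; apply/asboolP.
by exists (fun j => v (lift i j)); apply: spans_mod_drop Ic ci.
Qed.

Section Coordinates.
Context {n : nat} {v : 'I_n -> A} (spv : spans_mod v) (frv : free_mod v).

Definition coord_mod (a : A) : 'I_n -> k := projT1 (cid (spv a)).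

Lemma coord_modP a : I (a - \sum_(i < n) coord_mod a i *: v i).
Proof. by rewrite /coord_mod; case: cid. Qed.

(** Two expansions of [a] differ by a relation modulo [I], trivial by freeness. Identities between
    entries of [regular_mx] thus reduce to exhibiting one expansion. *)
Lemma coord_mod_uniq a (c : 'I_n -> k) :
  I (a - \sum_(i < n) c i *: v i) -> coord_mod a =1 c.
Proof.
move=> Ic i; apply/eqP; rewrite -subr_eq0; apply/eqP; move: i.
apply: frv; have := idealB Ic (coord_modP a).
under [X in _ -> I X]eq_bigr do rewrite scalerBl.
by rewrite sumrB opprB addrC addrA subrK.
Qed.

(** Coordinates are rows, on which matrices act from the right; with right multiplication by [a]
    this preserves the order of products. *)
Definition regular_mx (a : A) : matrix_alg k n :=
  \matrix_(i, j) coord_mod (v i * a) j.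

Lemma regular_mx_is_linear : linear regular_mx.
Proof.
move=> c a b; apply/matrixP=> i j; rewrite !mxE.
apply: (coord_mod_uniq (c := fun j => c * coord_mod (v i * a) j + coord_mod (v i * b) j)).
under eq_bigr do rewrite scalerDl -scalerA.
rewrite big_split /= -scaler_sumr mulrDr.
have -> : v i * (c *: a) = c *: (v i * a) by exact/esym/(@pzalg_scalerAr k A).
rewrite opprD addrACA -scalerBr.
by apply: (idealD idI); [apply: idealZ |]; exact: coord_modP.
Qed.

HB.instance Definition _ :=
  GRing.isLinear.Build k A (matrix_alg k n) *:%R regular_mx regular_mx_is_linear.

(** Multiplying by [b] on the right keeps the congruence, and each [v i * b] is then expanded by row
    [i] of [regular_mx b]. *)
Lemma mod_span_mul a (c : 'I_n -> k) b : I (a - \sum_(i < n) c i *: v i) ->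
  I (a * b - \sum_(j < n) (\sum_(i < n) c i * regular_mx b i j) *: v j).
Proof.
move=> Ic; have := Defs.idealMr idI b Ic; rewrite mulrBl => Iab.
set y := (\sum_i _) * b in Iab; rewrite -(subrK y (a * b)) -addrA.
apply: (idealD idI) => //; rewrite /y mulr_suml.
under [X in _ - X]eq_bigr do rewrite scaler_suml.
rewrite exchange_big -sumrB /=; apply: ideal_sum => i.
have -> : c i *: v i * b = c i *: (v i * b) by exact/esym/(@pzalg_scalerAl k A).
under eq_bigr do rewrite -scalerA mxE.
by rewrite -scaler_sumr -scalerBr; apply: idealZ; exact: coord_modP.
Qed.

Lemma regular_mx_monoid_morphism : monoid_morphism regular_mx.
Proof.
split=> [|a b]; apply/matrixP=> i j; rewrite !mxE.
  apply: (coord_mod_uniq (c := fun j => (i == j)%:R)); rewrite mulr1.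
  rewrite (bigD1 i) //= eqxx scale1r big1 => [|l /negbTE].
    by rewrite addr0 subrr; exact: (ideal0 idI).
  by rewrite eq_sym => ->; rewrite scale0r.
rewrite (coord_mod_uniq (c := fun j => \sum_l coord_mod (v i * a) l * regular_mx b l j)).
  by apply: eq_bigr => l _; rewrite !mxE.
(* By associativity, row [i] for [a * b] is the coordinate row of [v i * a] times the matrix of
   [b]. *)
by rewrite mulrA; apply: mod_span_mul; exact: coord_modP.
Qed.

Lemma factor_regular_mx (phi : {linear A -> k^o}) :
    I `<=` [set a | phi a = 0] ->
  exists psi : {linear matrix_alg k n -> k^o}, phi = psi \o regular_mx.
Proof.
move=> Iphi.
(* The coordinate row of 1 times [M], paired with the values [phi (v j)]. For [M = regular_mx a]
   that row represents [1 * a = a] modulo [I], where [phi] vanishes. *)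
pose psi0 (M : matrix_alg k n) : k^o :=
  \sum_(j < n) (\sum_(i < n) coord_mod 1 i * M i j) * phi (v j).
have psi0_lin : linear psi0.
  move=> c M N; rewrite /psi0 scaler_sumr -big_split /=; apply: eq_bigr => j _.
  rewrite -[c *: (_ * _)]/(c * _) mulrA -mulrDl mulr_sumr -big_split /=; congr (_ * _).
  by apply: eq_bigr => i _; rewrite !mxE mulrDr mulrCA.
pose psiL := GRing.isLinear.Build k (matrix_alg k n) k^o *:%R psi0 psi0_lin.
pose psi : {linear matrix_alg k n -> k^o} := HB.pack psi0 psiL.
exists psi; apply: linear_ext => a /=.
have /Iphi /= := mod_span_mul a (coord_modP 1).
rewrite mul1r linearB /= => /eqP; rewrite subr_eq0 => /eqP ->.
by rewrite linear_sum; apply: eq_bigr => j _; rewrite linearZ.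
Qed.

End Coordinates.
End QuotientBasis.

Theorem theorem3p6 (k : fieldType)
    (F : forall A : pzAlgType k, set {linear A -> k^o})
    (F_sub : finite_dual_subfunctor F)
    (F_mx : forall d : nat, F (matrix_alg k d) = [set: {linear matrix_alg k d -> k^o}]) :
  forall A : pzAlgType k, F A = finite_dual A.
Proof.
move=> A; apply/seteqP; split; first exact: subcoalg_sub (subfunctor_obj F_sub A).
move=> phi [I [idI /(finite_codim_basis idI)[n [v [spv frv]]] Iphi]].
have [psi ->] := factor_regular_mx idI spv frv Iphi.
(* The size [n] is 0 exactly when [I] is all of [A]; the hypothesis on the zero matrix algebra
   covers that case. *)
apply: (subfunctor_map F_sub); first exact: regular_mx_monoid_morphism.
by rewrite F_mx.
Qed.
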